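(* Let $s\ge 1$, $n_1,\dots,n_s\ge 3$, and let $L=FR(n_{n_1,1}\oplus n_{n_2,1}\oplus\dots\oplus n_{n_s,1})$ be a Leibniz algebra over $\mathbb{F}$ whose corresponding Lie algebra $L/I$ is isomorphic to $n_{n_1,1}\oplus\dots\oplus n_{n_s,1}$ and such that, under this isomorphism, the module $I$ is isomorphic to the Fock module $\mathbb{F}[x_1,\dots,x_s]$. Then $L$ admits a basis $$\Big\{\overline{1_i},\ \overline{x_i^j},\ \frac{\overline{\delta}}{\delta x_i},\ x_1^{t_1}x_2^{t_2}\cdots x_s^{t_s}\ \Big|\ t_1,\dots,t_s\in\mathbb{N}\cup\{0\},\ 1\le i\le s,\ 1\le j\le n_i-2\Big\}$$ in which the multiplication table is $$\begin{array}{l} [\overline{x_i^j},\frac{\overline{\delta}}{\delta x_i}]=j\,\overline{x_i^{j-1}},\qquad [\frac{\overline{\delta}}{\delta x_i},\overline{x_i^j}]=-j\,\overline{x_i^{j-1}},\\[1mm] [x_1^{t_1}\cdots x_s^{t_s},\overline{1_i}]=x_1^{t_1}\cdots x_s^{t_s},\\[1mm] [x_1^{t_1}\cdots x_s^{t_s},\overline{x_i^j}]=x_1^{t_1}\cdots x_{i-1}^{t_{i-1}}x_i^{t_i+j}x_{i+1}^{t_{i+1}}\cdots x_s^{t_s},\\[1mm] [x_1^{t_1}\cdots x_s^{t_s},\frac{\overline{\delta}}{\delta x_i}]=t_i\,x_1^{t_1}\cdots x_{i-1}^{t_{i-1}}x_i^{t_i-1}x_{i+1}^{t_{i+1}}\cdots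 x_s^{t_s}, \end{array}$$ for $1\le i\le s$, $1\le j\le n_i-2$, where $\overline{x_i^0}=\overline{1_i}$, and all omitted products of basis elements are zero.
   Context: $\mathbb{F}$ is an algebraically closed field of characteristic zero. A Leibniz algebra is an algebra $(L,[-,-])$ over $\mathbb{F}$ satisfying $[[x,y],z]=[[x,z],y]+[x,[y,z]]$ for all $x,y,z\in L$. Let $I$ be the ideal of $L$ generated by all squares $[x,x]$, $x\in L$. Then $[L,I]=0$, $L/I$ is a Lie algebra (the corresponding Lie algebra of $L$), and $I$ is an $L/I$-module via $I\times L/I\to I$, $(i,\overline{x})\mapsto[i,x]$. $n_{m,1}$ is the $m$-dimensional Lie algebra with basis $x_1,\dots,x_m$ and nonzero products $[x_k,x_1]=-[x_1,x_k]=x_{k+1}$ for $2\le k\le m-1$. Let $x_{i,1},\dots,x_{i,n_i}$ be this standard basis for the summand $n_{n_i,1}$, and put $\frac{\overline{\delta}}{\delta x_i}=x_{i,1}$ and $\overline{x_i^{n_i-j}}=(n_i-j)!\,x_{i,j}$ for $2\le j\le n_i$ (so $\overline{1_i}=\overline{x_i^0}=x_{i,n_i}$). The Fock module of $n_{n_1,1}\oplus\dots\oplus n_{n_s,1}$ is the space $\mathbb{F}[x_1,\dots,x_s]$ with the (right) action $$(p,\overline{1_i})\mapsto p,\quad (p,\overline{x_i^j})\mapsto x_i^jp,\quad \Big(p,\frac{\overline{\delta}}{\delta x_i}\Big)\mapsto\frac{\partial p}{\partial x_i}$$ for $p\in\mathbb{F}[x_1,\dots,x_s]$ and $1\le i\le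 s$. *)

(* Defs.v *)
From HB Require Import structures.
From mathcomp Require Import all_boot all_order all_algebra.
From mathcomp Require Import boolp.
From mathcomp Require Import mpoly.

Set Implicit Arguments.
Unset Strict Implicit.
Unset Printing Implicit Defensive.

Import GRing.Theory.
Local Open Scope ring_scope.
Local Open Scope quotient_scope.

Reserved Notation "⁅ x , y ⁆" (at level 0, x, y at level 99, format "⁅ x ,  y ⁆").

(* Right Leibniz algebras: every right multiplication is a derivation. *)
HB.mixin Record Lmodule_isLeibniz (F : fieldType) L of GRing.Lmodule F L := {
  brk : L -> L -> L;
  brk_linearl : forall y, linear (brk^~ y);
  brk_linearr : forall x, linear (brk x);
  brk_leibniz : forall x y z,
    brk (brk x y) z = brk (brk x z) y + brk x (brk y z)
}.

#[short(type="leibnizType")]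
HB.structure Definition Leibniz (F : fieldType) :=
  {L of GRing.Lmodule F L & Lmodule_isLeibniz F L}.

Notation "⁅ x , y ⁆" := (brk x y) : ring_scope.

Definition leibniz_iso (F : fieldType) (L M : leibnizType F) (phi : L -> M) :=
  [/\ linear phi, bijective phi & forall x y, phi ⁅x, y⁆ = ⁅phi x, phi y⁆].

(* [aU : U -> L -> U] and [aV : V -> M -> V] are right actions, and V is
   regarded as an L-module through [phi]. *)
Definition module_iso (F : fieldType) (L M : leibnizType F) (phi : L -> M)
    (U V : lmodType F) (aU : U -> L -> U) (aV : V -> M -> V) (psi : U -> V) :=
  [/\ linear psi, bijective psi & forall u x, psi (aU u x) = aV (psi u) (phi x)].

Section Bracket.
Variables (F : fieldType) (L : leibnizType F).
Implicit Types (a : F) (x y z : L).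

Lemma brkDl x y z : ⁅x + y, z⁆ = ⁅x, z⁆ + ⁅y, z⁆.
Proof. by have := brk_linearl z 1 x y; rewrite !scale1r. Qed.
Lemma brkDr x y z : ⁅z, x + y⁆ = ⁅z, x⁆ + ⁅z, y⁆.
Proof. by have := brk_linearr z 1 x y; rewrite !scale1r. Qed.
Lemma brk0l x : ⁅0, x⁆ = 0.
Proof. by apply: (addrI ⁅0, x⁆); rewrite -brkDl !addr0. Qed.
Lemma brk0r x : ⁅x, 0⁆ = 0.
Proof. by apply: (addrI ⁅x, 0⁆); rewrite -brkDr !addr0. Qed.
Lemma brkZl a x y : ⁅a *: x, y⁆ = a *: ⁅x, y⁆.
Proof. by have := brk_linearl y a x 0; rewrite brk0l !addr0. Qed.
Lemma brkZr a x y : ⁅y, a *: x⁆ = a *: ⁅y, x⁆.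
Proof. by have := brk_linearr y a x 0; rewrite brk0r !addr0. Qed.
Lemma brkNl x y : ⁅- x, y⁆ = - ⁅x, y⁆.
Proof. by rewrite -scaleN1r brkZl scaleN1r. Qed.
Lemma brkNr x y : ⁅y, - x⁆ = - ⁅y, x⁆.
Proof. by rewrite -scaleN1r brkZr scaleN1r. Qed.

Definition is_ideal (J : L -> Prop) :=
  [/\ J 0, forall a x y, J x -> J y -> J (a *: x + y)
    & forall x y, J x -> J ⁅x, y⁆ /\ J ⁅y, x⁆].

(* The ideal generated by the squares, as a (classical) boolean predicate. *)
Definition sqI : {pred L} := fun x =>
  `[< forall J : L -> Prop, is_ideal J -> (forall y, J ⁅y, y⁆) -> J x >].

Lemma sqIP x :
  reflect (forall J : L -> Prop, is_ideal J -> (forall y, J ⁅y, y⁆) -> J x)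
          (x \in sqI).
Proof. exact: asboolP. Qed.

Lemma sqI_submod : submod_closed sqI.
Proof.
split=> [|a x y /sqIP Ix /sqIP Iy]; apply/sqIP => J idJ sqJ.
  by case: idJ.
by case: (idJ) => _ JD _; apply: JD; [apply: Ix | apply: Iy].
Qed.

HB.instance Definition _ := GRing.isSubmodClosed.Build F L sqI sqI_submod.

Lemma sqI_brkl x y : x \in sqI -> ⁅x, y⁆ \in sqI.
Proof.
move=> /sqIP Ix; apply/sqIP => J idJ sqJ.
by case: (idJ) => _ _ JM; case: (JM x y (Ix J idJ sqJ)).
Qed.

Lemma sqI_brkr x y : x \in sqI -> ⁅y, x⁆ \in sqI.
Proof.
move=> /sqIP Ix; apply/sqIP => J idJ sqJ.
by case: (idJ) => _ _ JM; case: (JM x y (Ix J idJ sqJ)).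
Qed.

Lemma sqI_sq x : ⁅x, x⁆ \in sqI.
Proof. by apply/sqIP. Qed.

Lemma brk_sqI x y : y \in sqI -> ⁅x, y⁆ = 0.
Proof.
move=> /sqIP Iy; move: x; apply: (Iy (fun y => forall x, ⁅x, y⁆ = 0)); last first.
  by move=> z x; apply: (addrI ⁅⁅x, z⁆, z⁆); rewrite -brk_leibniz addr0.
split=> [x|a u v u0 v0 x|u v u0]; first exact: brk0r.
  by rewrite brkDr brkZr u0 v0 scaler0 addr0.
split=> x; last by rewrite u0 brk0r.
by have := brk_leibniz x u v; rewrite !u0 brk0l add0r => <-.
Qed.

End Bracket.

Section Quotient.
Variables (F : fieldType) (L : leibnizType F).

Definition sqI_mod := {x : L | x \in sqI (L := L)}.
HB.instance Definition _ := SubType.on sqI_mod.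
HB.instance Definition _ := Choice.on sqI_mod.
HB.instance Definition _ := [SubChoice_isSubLmodule of sqI_mod by <:].

Definition Lquot := {ideal_quot (sqI (L := L))}.
HB.instance Definition _ := GRing.Zmodule.on Lquot.

Local Notation pi := (\pi_{ideal_quot (sqI (L := L))} : L -> Lquot).
Implicit Types (a : F) (x y : L) (u v : Lquot).

Lemma LquotP x y : reflect (pi x = pi y) (x - y \in sqI (L := L)).
Proof. by rewrite Quotient.idealrBE; apply: eqP. Qed.

Lemma pi_repr u : pi (repr u) = u.
Proof. exact: reprK. Qed.

Lemma Lquot_ind (P : Lquot -> Prop) : (forall x, P (pi x)) -> forall u, P u.
Proof. by move=> Px u; rewrite -[u]pi_repr. Qed.

Lemma piD x y : pi (x + y) = pi x + pi y.
Proof. by rewrite -[RHS]/(_ + _) raddfD. Qed.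

Definition qscale a u : Lquot := pi (a *: repr u).
Definition qbrk u v : Lquot := pi ⁅repr u, repr v⁆.

Lemma repr_pi x : repr (pi x) - x \in sqI (L := L).
Proof. by apply/LquotP; rewrite pi_repr. Qed.

Lemma qscale_pi a x : qscale a (pi x) = pi (a *: x).
Proof. by apply/LquotP; rewrite -scalerBr rpredZ // repr_pi. Qed.

Lemma qbrk_pi x y : qbrk (pi x) (pi y) = pi ⁅x, y⁆.
Proof.
apply/LquotP; set a := repr _; set b := repr _.
have -> : ⁅a, b⁆ - ⁅x, y⁆ = ⁅a - x, b⁆ + ⁅x, b - y⁆.
  by rewrite brkDl brkDr brkNl brkNr addrA subrK.
by apply: rpredD; [apply: sqI_brkl | apply: sqI_brkr]; apply: repr_pi.
Qed.

Fact qscaleA a b u : qscale a (qscale b u) = qscale (a * b) u.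
Proof. by elim/Lquot_ind: u => x; rewrite !qscale_pi scalerA. Qed.
Fact qscale1 : left_id 1 qscale.
Proof. by elim/Lquot_ind=> x; rewrite qscale_pi scale1r. Qed.
Fact qscaleDr : right_distributive qscale +%R.
Proof.
move=> a; elim/Lquot_ind=> x; elim/Lquot_ind=> y.
by rewrite -piD !qscale_pi scalerDr piD.
Qed.
Fact qscaleDl u : {morph qscale^~ u : a b / a + b}.
Proof.
by elim/Lquot_ind: u => x a b; rewrite !qscale_pi scalerDl piD.
Qed.

HB.instance Definition _ := GRing.Zmodule_isLmodule.Build F Lquot
  qscaleA qscale1 qscaleDr qscaleDl.

Fact qbrk_linearl v : linear (qbrk^~ v).
Proof.
move=> a; elim/Lquot_ind=> x; elim/Lquot_ind=> y; elim/Lquot_ind: v => z.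
rewrite -[a *: pi x]/(qscale a (pi x)) -[a *: qbrk _ _]/(qscale a _).
by rewrite qscale_pi -piD !qbrk_pi qscale_pi brkDl brkZl piD.
Qed.
Fact qbrk_linearr u : linear (qbrk u).
Proof.
move=> a; elim/Lquot_ind=> x; elim/Lquot_ind=> y; elim/Lquot_ind: u => z.
rewrite -[a *: pi x]/(qscale a (pi x)) -[a *: qbrk _ _]/(qscale a _).
by rewrite qscale_pi -piD !qbrk_pi qscale_pi brkDr brkZr piD.
Qed.
Fact qbrk_leibniz u v w :
  qbrk (qbrk u v) w = qbrk (qbrk u w) v + qbrk u (qbrk v w).
Proof.
elim/Lquot_ind: u => x; elim/Lquot_ind: v => y; elim/Lquot_ind: w => z.
by rewrite !qbrk_pi -piD brk_leibniz.
Qed.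

HB.instance Definition _ := Lmodule_isLeibniz.Build F Lquot
  qbrk_linearl qbrk_linearr qbrk_leibniz.

(* The choice of a representative is irrelevant, see [sqI_act_pi]. *)
Definition sqI_act (i : sqI_mod) (u : Lquot) : sqI_mod :=
  exist _ ⁅val i, repr u⁆ (sqI_brkl (repr u) (valP i)).

Lemma sqI_act_pi i x : val (sqI_act i (pi x)) = ⁅val i, x⁆.
Proof.
apply/eqP; rewrite -subr_eq0 /= -brkNr -brkDr; apply/eqP.
exact/brk_sqI/repr_pi.
Qed.

End Quotient.

Section DirectSum.
Variables (F : fieldType) (I : finType) (G : I -> leibnizType F).

Definition dsum := {dffun forall i : I, G i}.
HB.instance Definition _ := Choice.on dsum.
Implicit Types (u v w : dsum).

Definition ds_zero : dsum := [ffun i => (0 : G i)].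
Definition ds_opp u : dsum := [ffun i => - u i].
Definition ds_add u v : dsum := [ffun i => u i + v i].
Definition ds_scale (a : F) u : dsum := [ffun i => a *: u i].
Definition ds_brk u v : dsum := [ffun i => ⁅u i, v i⁆].

Fact ds_addA : associative ds_add.
Proof. by move=> u v w; apply/ffunP => i; rewrite !ffunE addrA. Qed.
Fact ds_addC : commutative ds_add.
Proof. by move=> u v; apply/ffunP => i; rewrite !ffunE addrC. Qed.
Fact ds_add0 : left_id ds_zero ds_add.
Proof. by move=> u; apply/ffunP => i; rewrite !ffunE add0r. Qed.
Fact ds_addN : left_inverse ds_zero ds_opp ds_add.
Proof. by move=> u; apply/ffunP => i; rewrite !ffunE addNr. Qed.
HB.instance Definition _ :=
  GRing.isZmodule.Build dsum ds_addA ds_addC ds_add0 ds_addN.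

Fact ds_scaleA a b u : ds_scale a (ds_scale b u) = ds_scale (a * b) u.
Proof. by apply/ffunP => i; rewrite !ffunE scalerA. Qed.
Fact ds_scale1 : left_id 1 ds_scale.
Proof. by move=> u; apply/ffunP => i; rewrite !ffunE scale1r. Qed.
Fact ds_scaleDr : right_distributive ds_scale +%R.
Proof. by move=> a u v; apply/ffunP => i; rewrite !ffunE scalerDr. Qed.
Fact ds_scaleDl u : {morph ds_scale^~ u : a b / a + b}.
Proof. by move=> a b; apply/ffunP => i; rewrite !ffunE scalerDl. Qed.
HB.instance Definition _ := GRing.Zmodule_isLmodule.Build F dsum
  ds_scaleA ds_scale1 ds_scaleDr ds_scaleDl.

Fact ds_brk_linearl v : linear (ds_brk^~ v).
Proof. by move=> a u w; apply/ffunP => i; rewrite !ffunE brk_linearl. Qed.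
Fact ds_brk_linearr u : linear (ds_brk u).
Proof. by move=> a v w; apply/ffunP => i; rewrite !ffunE brk_linearr. Qed.
Fact ds_brk_leibniz u v w :
  ds_brk (ds_brk u v) w = ds_brk (ds_brk u w) v + ds_brk u (ds_brk v w).
Proof. by apply/ffunP => i; rewrite !ffunE brk_leibniz. Qed.
HB.instance Definition _ := Lmodule_isLeibniz.Build F dsum
  ds_brk_linearl ds_brk_linearr ds_brk_leibniz.

Definition dsinj (i : I) (x : G i) : dsum :=
  [ffun k => dfwith (fun=> 0) x k : G k].

End DirectSum.

Section Filiform.
Variables (F : fieldType) (m : nat).

(* n_{m,1} in coordinates on its standard basis.  Coordinate [j : 'I_m] is the
   coefficient of x_{j+1}; [nbas k] is x_k with the 1-based index k, and it is
   0 unless 1 <= k <= m. *)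
Definition nfil := 'rV[F]_m.
HB.instance Definition _ := GRing.Lmodule.on nfil.

Definition nbas (k : nat) : nfil := \row_(j < m) (j.+1 == k)%:R.

Definition nbrk_bas (k l : nat) : nfil :=
  if (1 < k < m)%N && (l == 1%N) then nbas k.+1
  else if (1 < l < m)%N && (k == 1%N) then - nbas l.+1
  else 0.

Definition nbrk (u v : nfil) : nfil :=
  \sum_(k < m) \sum_(l < m) (u 0 k * v 0 l) *: nbrk_bas k.+1 l.+1.

Fact nbrk_linearl v : linear (nbrk^~ v).
Proof.
move=> a u w; rewrite /nbrk scaler_sumr -big_split /=; apply: eq_bigr => k _.
rewrite scaler_sumr -big_split /=; apply: eq_bigr => l _.
by rewrite !mxE scalerA -scalerDl mulrDl mulrA.
Qed.

Fact nbrk_linearr u : linear (nbrk u).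
Proof.
move=> a v w; rewrite /nbrk scaler_sumr -big_split /=; apply: eq_bigr => k _.
rewrite scaler_sumr -big_split /=; apply: eq_bigr => l _.
by rewrite !mxE scalerA -scalerDl mulrDr mulrCA.
Qed.

Let top1 (u : nfil) : F := \sum_(k < m) u 0 k * (k.+1 == 1%N)%:R.
Let dbas k : nfil := if (1 < k < m)%N then nbas k.+1 else 0.
Let shift (u : nfil) : nfil := \sum_(k < m) u 0 k *: dbas k.+1.

Let nbrk_basE k l :
  nbrk_bas k l = (l == 1%N)%:R *: dbas k - (k == 1%N)%:R *: dbas l.
Proof.
rewrite /nbrk_bas /dbas.
have [->|l1] := eqVneq l 1%N; have [->|k1] := eqVneq k 1%N;
  rewrite ?ltnn ?andbF ?andbT /= ?scale1r ?scale0r ?subr0 ?sub0r //.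
by case: ifP; rewrite ?oppr0.
Qed.

Let nbrkE u v : nbrk u v = top1 v *: shift u - top1 u *: shift v.
Proof.
have -> : top1 v *: shift u = \sum_(k < m) \sum_(l < m)
    (u 0 k * v 0 l) *: ((l.+1 == 1%N)%:R *: dbas k.+1).
  rewrite /shift scaler_sumr; apply: eq_bigr => k _.
  rewrite /top1 scaler_suml; apply: eq_bigr => l _.
  by rewrite !scalerA; congr (_ *: _); rewrite mulrC mulrA.
have -> : top1 u *: shift v = \sum_(k < m) \sum_(l < m)
    (u 0 k * v 0 l) *: ((k.+1 == 1%N)%:R *: dbas l.+1).
  rewrite /top1 scaler_suml; apply: eq_bigr => k _.
  rewrite /shift scaler_sumr; apply: eq_bigr => l _.
  by rewrite !scalerA mulrAC.
rewrite -sumrB; apply: eq_bigr => k _; rewrite -sumrB; apply: eq_bigr => l _.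
by rewrite nbrk_basE scalerBr.
Qed.

Let top1Z a u : top1 (a *: u) = a * top1 u.
Proof.
by rewrite mulr_sumr; apply: eq_bigr => k _; rewrite mxE mulrA.
Qed.
Let top1B u v : top1 (u - v) = top1 u - top1 v.
Proof.
by rewrite -sumrB; apply: eq_bigr => k _; rewrite !mxE mulrBl.
Qed.
Let shiftZ a u : shift (a *: u) = a *: shift u.
Proof.
by rewrite scaler_sumr; apply: eq_bigr => k _; rewrite mxE scalerA.
Qed.
Let shiftB u v : shift (u - v) = shift u - shift v.
Proof.
by rewrite -sumrB; apply: eq_bigr => k _; rewrite !mxE scalerBl.
Qed.
Let top1_shift u : top1 (shift u) = 0.
Proof.
rewrite /top1 big1 // => k _; rewrite /shift summxE mulr_suml big1 // => l _.
rewrite mxE /dbas; case: ifP => _; rewrite ?mxE ?mulr0 ?mul0r //.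
by case: eqP => [->|_]; rewrite ?mulr0 ?mul0r.
Qed.

Fact nbrk_leibniz u v w :
  nbrk (nbrk u v) w = nbrk (nbrk u w) v + nbrk u (nbrk v w).
Proof.
rewrite !nbrkE !(top1B, top1Z, shiftB, shiftZ, top1_shift) !mulr0 subr0 !scale0r.
rewrite !subr0 sub0r !scalerBr !scalerA opprB addrA.
by rewrite [top1 v * top1 w]mulrC [top1 v * top1 u]mulrC subrK [top1 u * _]mulrC.
Qed.

HB.instance Definition _ := Lmodule_isLeibniz.Build F nfil
  nbrk_linearl nbrk_linearr nbrk_leibniz.

Lemma nfil_alt (u : nfil) : ⁅u, u⁆ = 0.
Proof. by rewrite [LHS]nbrkE subrr. Qed.

Lemma nbrk_nbas (k l : nat) : (0 < k <= m)%N -> (0 < l <= m)%N ->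
  ⁅nbas k, nbas l⁆ = nbrk_bas k l.
Proof.
case: k => // k /= km; case: l => // l /= lm.
rewrite [LHS](bigD1 (Ordinal km)) //= (bigD1 (Ordinal lm)) //= !mxE !eqxx.
rewrite mulr1 scale1r !big1 ?addr0 // => [i ni|i ni].
  rewrite big1 // => j _; rewrite mxE eqSS.
  by rewrite -[k]/(val (Ordinal km)) val_eqE (negPf ni) mul0r scale0r.
rewrite !mxE eqSS.
by rewrite -[l in _ == l]/(val (Ordinal lm)) val_eqE (negPf ni) mulr0 scale0r.
Qed.

End Filiform.

Section Fock.
Variables (F : fieldType) (s : nat) (n : 'I_s -> nat).

Definition nsum := dsum (fun i => nfil F (n i)).

(* [nx i j] is x_{i,j}; [nbar i k] is \overline{x_i^k}, so that [nbar i 0] is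
   \overline{1_i}; [nder i] is \overline{\delta} / \delta x_i. *)
Definition nx (i : 'I_s) (j : nat) : nsum :=
  dsinj (G := fun i => nfil F (n i)) (nbas F (n i) j).
Definition nbar (i : 'I_s) (k : nat) : nsum := (k`!)%:R *: nx i (n i - k).
Definition nder (i : 'I_s) : nsum := nx i 1.

(* The Fock action extended linearly from the basis x_{i,j} of [nsum]: since
   x_{i,j} = \overline{x_i^(n_i-j)} / (n_i-j)! for j >= 2, it acts as
   multiplication by x_i^(n_i-j) / (n_i-j)!.  The values on [nbar] and [nder]
   are given by [fock_nbar] and [fock_nder]. *)
Definition fock_bas (p : {mpoly F[s]}) (i : 'I_s) (j : nat) : {mpoly F[s]} :=
  if j == 1%N then p^`M(i)
  else ((n i - j)`!)%:R^-1 *: ('X_i ^+ (n i - j) * p).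

Definition fock (p : {mpoly F[s]}) (g : nsum) : {mpoly F[s]} :=
  \sum_(i < s) \sum_(j < n i) (g i : nfil F (n i)) 0 j *: fock_bas p i j.+1.

Lemma fock_nx p i j : (0 < j <= n i)%N -> fock p (nx i j) = fock_bas p i j.
Proof.
case: j => // j /= ji; rewrite /fock (bigD1 i) //= (bigD1 (Ordinal ji)) //=.
rewrite ffunE dfwith_in mxE eqxx scale1r !big1 ?addr0 // => [k ki|k kj].
  by rewrite big1 // => l _; rewrite ffunE dfwith_out 1?eq_sym // mxE scale0r.
rewrite mxE eqSS.
by rewrite -[j in _ == j]/(val (Ordinal ji)) val_eqE (negPf kj) scale0r.
Qed.

Lemma fockZ p a g : fock p (a *: g) = a *: fock p g.
Proof.
rewrite /fock scaler_sumr; apply: eq_bigr => i _.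
by rewrite scaler_sumr; apply: eq_bigr => j _; rewrite !ffunE mxE scalerA.
Qed.

Lemma fock_nder p i : (0 < n i)%N -> fock p (nder i) = p^`M(i).
Proof. by move=> ni; rewrite fock_nx ?ni. Qed.

Lemma fock_nbar p i k : [pchar F] =i pred0 -> (k.+1 < n i)%N ->
  fock p (nbar i k) = 'X_i ^+ k * p.
Proof.
move=> F0 ki; have kn : (k <= n i)%N by rewrite ltnW // ltnW.
rewrite fockZ fock_nx; last by rewrite subn_gt0 leq_subr ltnW.
rewrite /fock_bas subKn // ifF; last first.
  by apply/eqP => e; move: ki; rewrite -subn_gt0 subnS e.
by rewrite scalerA divff ?scale1r // ((pcharf0P F).1 F0) -lt0n fact_gt0.
Qed.

End Fock.

(* [L] is FR(n_{n_1,1} + ... + n_{n_s,1}). *)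
Definition is_FR (F : fieldType) (s : nat) (n : 'I_s -> nat)
    (L : leibnizType F) : Prop :=
  exists (phi : Lquot L -> nsum F n) (psi : sqI_mod L -> {mpoly F[s]}),
    leibniz_iso phi /\ module_iso phi (@sqI_act F L) (@fock F s n) psi.

Definition is_basis (F : fieldType) (V : lmodType F) (T : Type) (e : T -> V) :=
  (forall k (f : 'I_k -> T) (c : 'I_k -> F), injective f ->
     \sum_(i < k) c i *: e (f i) = 0 -> forall i, c i = 0) /\
  (forall v, exists k (f : 'I_k -> T) (c : 'I_k -> F),
     v = \sum_(i < k) c i *: e (f i)).

(* [Bar i j], for 0 <= j <= n_i - 2, stands for \overline{x_i^j}, with
   [Bar i 0] for \overline{1_i}. *)
Inductive FR_index (s : nat) (n : 'I_s -> nat) :=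
| Bar (i : 'I_s) (j : 'I_(n i).-1)
| Der (i : 'I_s)
| Mon (t : 'X_{1..s}).

(* The cyclic [ord_pred j] and the truncated [t - U_(i)] only matter when the
   coefficient j, resp. t_i, is nonzero. *)
Definition FR_table (F : fieldType) (s : nat) (n : 'I_s -> nat) (V : lmodType F)
    (e : FR_index n -> V) (a b : FR_index n) : V :=
  match a, b with
  | Bar i j, Der k => if i == k then j%:R *: e (Bar (ord_pred j)) else 0
  | Der k, Bar i j => if i == k then - (j%:R *: e (Bar (ord_pred j))) else 0
  | Mon t, Bar i j => e (Mon n (t + U_(i) *+ j)%MM)
  | Mon t, Der i => (t i)%:R *: e (Mon n (t - U_(i))%MM)
  | _, _ => 0
  end.

(* Main.v *)
Require Import Defs.
From HB Require Import structures.
From mathcomp Require Import all_boot all_order all_algebra.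
From mathcomp Require Import boolp.
From mathcomp Require Import mpoly.
From mathcomp Require Import zify.

Set Implicit Arguments.
Unset Strict Implicit.
Unset Printing Implicit Defensive.

Import GRing.Theory.
Local Open Scope ring_scope.
Local Open Scope quotient_scope.

(** The extension I -> L -> L/I splits, and the reason is that some element of
    L/I, namely any one of the \overline{1_i}, is central in L/I but acts on I
    as the identity.

    Let z be a lift of \overline{1_i} to L. Right multiplication by z sends L
    into I, because \overline{1_i} is central, and is the identity on I; it is
    therefore a linear projection of L onto I. Let K = {x | [x, z] = 0} be its
    kernel, so that L = K + I is a direct sum of vector spaces. As right
    multiplication by z is a derivation, K is a subalgebra, hence a copy of L/I
    inside L. With [L, I] = 0 this describes the whole bracket: L is the
    semidirect sum of n_{n_1,1} + ... + n_{n_s,1} and of the Fock module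
    ([FR_semidirect]), where the complement is the image of [zlift], the
    section of L -> L/I with values in K.

    The basis is then the union of the standard basis of the direct sum,
    rescaled by factorials, and of the monomials. It is studied in the concrete
    space of pairs (u, p): the multiplication table is [model_table], freeness
    comes from the dual family of coordinate functions [model_coord], and
    everything is carried to L by the linear bijection. Characteristic zero
    makes the factorials invertible. *)

(** * Bases and spanning families *)

Section Spanning.
Variables (F : fieldType) (V : lmodType F) (T : Type) (e : T -> V).

(** Lists of terms, rather than families indexed by ['I_k], so that sums are
    given by concatenation. *)
Definition in_span (v : V) :=
  exists r : seq (F * T), v = \sum_(x <- r) x.1 *: e x.2.

Lemma in_span0 : in_span 0.
Proof. by exists [::]; rewrite big_nil. Qed.

Lemma in_spanD u v : in_span u -> in_span v -> in_span (u + v).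
Proof. by move=> [r ->] [t ->]; exists (r ++ t); rewrite big_cat. Qed.

Lemma in_spanZ a v : in_span v -> in_span (a *: v).
Proof.
move=> [r ->]; exists [seq (a * x.1, x.2) | x <- r].
by rewrite big_map scaler_sumr; apply: eq_bigr => x _; rewrite scalerA.
Qed.

Lemma in_span_gen t : in_span (e t).
Proof. by exists [:: (1, t)]; rewrite big_seq1 scale1r. Qed.

(** The index type carries no decidable equality here, hence the two separate
    conditions in place of a Kronecker delta. *)
Lemma dual_basis (d : T -> V -> F) :
    (forall t, scalar (d t)) -> (forall t, d t (e t) = 1) ->
    (forall t u, t <> u -> d t (e u) = 0) -> (forall v, in_span v) ->
  is_basis e.
Proof.
move=> dlin d1 d0 eV; split=> [k f c f_inj e0 i|v]; last first.
  have [r ->] := eV v.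
  exists (size r), (fun i => (tnth (in_tuple r) i).2).
  by exists (fun i => (tnth (in_tuple r) i).1); rewrite big_tnth.
pose D : {scalar V} :=
  HB.pack (d (f i)) (GRing.isLinear.Build _ _ _ _ (d (f i)) (dlin _)).
have : D (\sum_(l < k) c l *: e (f l)) = D 0 by rewrite e0.
rewrite linear0 linear_sum (bigD1 i) // linearZ_LR big1 => [|l li].
  by rewrite /= addr0 d1 mulr1.
rewrite linearZ_LR /= d0 ?mulr0 // => /f_inj il.
by rewrite il eqxx in li.
Qed.

End Spanning.

Lemma is_basis_iso (F : fieldType) (U V : lmodType F) (T : Type) (e : T -> U)
    (h : U -> V) :
  linear h -> bijective h -> is_basis e -> is_basis (h \o e).
Proof.
move=> hlin [g hK gK] [e_free e_span].
pose H : {linear U -> V} := HB.pack h (GRing.isLinear.Build _ _ _ _ h hlin).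
have Hsum k (f : 'I_k -> T) (c : 'I_k -> F) :
    \sum_(i < k) c i *: (h \o e) (f i) = H (\sum_(i < k) c i *: e (f i)).
  by rewrite linear_sum; apply: eq_bigr => i _; rewrite linearZ.
split=> [k f c f_inj|v].
  rewrite Hsum -(linear0 H) => /(can_inj hK); exact: e_free.
have [k [f [c gv]]] := e_span (g v).
by exists k, f, c; rewrite Hsum -gv /= gK.
Qed.

(** * Brackets in the direct sum of filiform algebras *)

Section Brackets.
Variables (F : fieldType) (s : nat) (n : 'I_s -> nat).

Lemma dsinjZ (I : finType) (G : I -> leibnizType F) i a (x : G i) :
  a *: dsinj x = dsinj (a *: x).
Proof.
apply/ffunP => k; rewrite !ffunE; have [<-|ik] := eqVneq i k.
  by rewrite !dfwith_in.
by rewrite !dfwith_out // scaler0.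
Qed.

Lemma dsinjN (I : finType) (G : I -> leibnizType F) i (x : G i) :
  - dsinj x = dsinj (- x).
Proof. by rewrite -!scaleN1r dsinjZ. Qed.

Lemma dsinj0 (I : finType) (G : I -> leibnizType F) i : dsinj (0 : G i) = 0.
Proof. by rewrite -(scale0r 0) -dsinjZ scale0r. Qed.

Lemma brk_dsinj (I : finType) (G : I -> leibnizType F) i (x y : G i) :
  ⁅dsinj x, dsinj y⁆ = dsinj ⁅x, y⁆.
Proof.
apply/ffunP => k; rewrite !ffunE; have [<-|ik] := eqVneq i k.
  by rewrite !dfwith_in.
by rewrite !dfwith_out // brk0l.
Qed.

Lemma brk_dsinj_neq (I : finType) (G : I -> leibnizType F) i k (x : G i) (y : G k) :
  i != k -> ⁅dsinj x, dsinj y⁆ = 0.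
Proof.
move=> ik; apply/ffunP => l; rewrite !ffunE; have [<-|il] := eqVneq i l.
  by rewrite [dfwith _ y _]dfwith_out ?brk0r // eq_sym.
by rewrite dfwith_out // brk0l.
Qed.

Lemma brk_nbar i k (j l : nat) : (j.+1 < n i)%N -> (l.+1 < n k)%N ->
  ⁅nbar F n i j, nbar F n k l⁆ = 0.
Proof.
move=> ji lk; rewrite brkZl brkZr; have [ik|ik] := eqVneq i k; last first.
  by rewrite brk_dsinj_neq // !scaler0.
case: _ / ik l lk => l li; rewrite brk_dsinj nbrk_nbas /nbrk_bas; try lia.
by rewrite !ifF ?dsinj0 ?scaler0 //; lia.
Qed.

Lemma brk_nder i k : (2 < n i)%N -> (2 < n k)%N -> ⁅nder F n i, nder F n k⁆ = 0.
Proof.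
move=> ni nk; have [ik|ik] := eqVneq i k; last by rewrite brk_dsinj_neq.
by case: _ / ik nk => _; rewrite brk_dsinj nfil_alt dsinj0.
Qed.

(** The predecessor [j.-1] may be left truncated: at [j = 0] both sides vanish,
    the left one because x_{i,n_i} ends the chain x_{i,k} -> x_{i,k+1}. *)
Lemma brk_nbar_nder i k j : (j.+1 < n i)%N ->
  ⁅nbar F n i j, nder F n k⁆ = if i == k then j%:R *: nbar F n i j.-1 else 0.
Proof.
move=> ji; rewrite brkZl; have [ik|ik] := eqVneq i k; last first.
  by rewrite brk_dsinj_neq ?scaler0.
case: _ / ik; rewrite brk_dsinj nbrk_nbas /nbrk_bas; try lia.
rewrite eqxx andbT; case: j ji => [|j] ji.
  by rewrite !ifF ?dsinj0 ?scaler0 ?scale0r //; lia.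
rewrite ifT; last by lia.
have e : ((n i - j.+1).+1 = n i - j)%N by lia.
by rewrite e /nbar scalerA -natrM -factS.
Qed.

Lemma brk_nder_nbar i k j : (j.+1 < n i)%N ->
  ⁅nder F n k, nbar F n i j⁆ = if i == k then - (j%:R *: nbar F n i j.-1) else 0.
Proof.
move=> ji; rewrite brkZr; have [ik|ik] := eqVneq i k; last first.
  by rewrite brk_dsinj_neq ?scaler0 1?eq_sym.
case: _ / ik; rewrite brk_dsinj nbrk_nbas /nbrk_bas; try lia.
rewrite ltnn /= eqxx andbT; case: j ji => [|j] ji.
  by rewrite !ifF ?dsinj0 ?scaler0 ?scale0r ?oppr0 //; lia.
rewrite ifT; last by lia.
rewrite -dsinjN scalerN; congr (- _).
have e : ((n i - j.+1).+1 = n i - j)%N by lia.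
by rewrite e /nbar scalerA -natrM -factS.
Qed.

(** Centrality of \overline{1_i}, which is the last basis vector x_{i,n_i}. *)
Lemma brk_nbar0 i u : (1 < n i)%N -> ⁅u, nbar F n i 0⁆ = 0.
Proof.
move=> ni; rewrite brkZr; apply/ffunP => k; rewrite !ffunE.
have [<-|ik] := eqVneq i k; last by rewrite dfwith_out // brk0r scaler0.
rewrite dfwith_in [X in _ *: X]big1 ?scaler0 // => j _.
rewrite big1 // => l _; rewrite mxE subn0.
have [->|_] := eqVneq l.+1 (n i); last by rewrite mulr0 scale0r.
by rewrite /nbrk_bas !ifF ?scaler0 //; lia.
Qed.

End Brackets.

(** * Splitting by an element acting as the identity on the squares *)

Section Splitting.
Variables (F : fieldType) (L : leibnizType F) (z : L).

Local Notation pi := (\pi_{ideal_quot (sqI (L := L))} : L -> Lquot L).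

Lemma piZ a x : pi (a *: x) = a *: pi x.
Proof. by rewrite -[RHS]/(qscale a (pi x)) qscale_pi. Qed.

Lemma pi_brk x y : pi ⁅x, y⁆ = ⁅pi x, pi y⁆.
Proof. by rewrite -[RHS]/(qbrk (pi x) (pi y)) qbrk_pi. Qed.

Lemma pi_eq0 x : (pi x = 0) <-> (x \in @sqI F L).
Proof.
have pi0 : pi 0 = 0 by rewrite -(scale0r (0 : L)) piZ scale0r.
by rewrite -pi0 -[X in X \in _]subr0; split=> /LquotP.
Qed.

(** Under the hypotheses below on [z], the projection onto the kernel of
    right multiplication by [z] along the ideal of squares. *)
Definition zproj (x : L) : L := x - ⁅x, z⁆.
Definition zlift (u : Lquot L) : L := zproj (repr u).

Hypothesis z_central : forall x, ⁅x, z⁆ \in @sqI F L.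
Hypothesis z_id : forall x, x \in @sqI F L -> ⁅x, z⁆ = x.

Lemma zproj_linear : linear zproj.
Proof.
by move=> a x y; rewrite /zproj brkDl brkZl opprD addrACA -scalerN -scalerDr.
Qed.

(** Subtracting an element of the ideal does not matter on the right; on the
    left, the equality is the derivation property of right multiplication by
    [z], whose term [x, [y, z]] vanishes. *)
Lemma zproj_brk x y : ⁅zproj x, zproj y⁆ = zproj ⁅x, y⁆.
Proof.
rewrite /zproj brkDr brkNr (brk_sqI _ (z_central y)) subr0 brkDl brkNl.
by rewrite [in RHS]brk_leibniz (brk_sqI _ (z_central y)) addr0.
Qed.

(** Two representatives of a class differ by an element of the ideal, on which
    [zproj] vanishes; the lift is thus independent of the representative. *)
Lemma zlift_pi x : zlift (pi x) = zproj x.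
Proof.
have I0 := z_id (repr_pi x); move: I0; rewrite brkDl brkNl => I0.
apply: subr0_eq; rewrite /zlift /zproj opprD addrACA -I0 opprK.
by rewrite addrACA subrr addNr addr0.
Qed.

Lemma zliftK u : pi (zlift u) = u.
Proof.
elim/Lquot_ind: u => x; rewrite zlift_pi; apply/LquotP.
by rewrite /zproj addrC addKr rpredN.
Qed.

Lemma zlift_linear : linear zlift.
Proof.
move=> a; elim/Lquot_ind=> x; elim/Lquot_ind=> y.
by rewrite -piZ -piD !zlift_pi zproj_linear.
Qed.

Lemma zlift_brk u v : ⁅zlift u, zlift v⁆ = zlift ⁅u, v⁆.
Proof.
elim/Lquot_ind: u => x; elim/Lquot_ind: v => y.
by rewrite -pi_brk !zlift_pi zproj_brk.
Qed.

Lemma zlift_z u : ⁅zlift u, z⁆ = 0.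
Proof. by rewrite brkDl brkNl (z_id (z_central _)) subrr. Qed.

Lemma zlift_val (i : sqI_mod L) u : ⁅val i, zlift u⁆ = val (sqI_act i u).
Proof. by rewrite -sqI_act_pi zliftK. Qed.

Lemma zlift_decomp x : x = zlift (pi x) + ⁅x, z⁆.
Proof. by rewrite zlift_pi subrK. Qed.

End Splitting.

(** * The semidirect sum with the Fock module *)

Section Model.
Variables (F : fieldType) (s : nat) (n : 'I_s -> nat).
Hypothesis charF : [pchar F] =i pred0.
Hypothesis n_ge3 : forall i, (3 <= n i)%N.

(** The element that splits L is a lift of \overline{1_i} for an arbitrary
    index: one summand is enough. The inverse of the bijection takes [x] to its
    class together with [x, z], the component of [x] in the ideal. *)
Lemma FR_semidirect (i0 : 'I_s) (L : leibnizType F) : is_FR n L ->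
  exists h : nsum F n * {mpoly F[s]} -> L,
    [/\ linear h, bijective h
      & forall a b, ⁅h a, h b⁆ = h (⁅a.1, b.1⁆, fock a.2 b.1)].
Proof.
case=> phi [psi [[phi_lin [phi' phiK phi'K] phi_brk]]].
case=> psi_lin [psi' psiK psi'K] psi_act.
pose pi := \pi_{ideal_quot (sqI (L := L))} : L -> Lquot L.
pose phiL : {linear Lquot L -> nsum F n} :=
  HB.pack phi (GRing.isLinear.Build _ _ _ _ phi phi_lin).
pose psiL : {linear sqI_mod L -> {mpoly F[s]}} :=
  HB.pack psi (GRing.isLinear.Build _ _ _ _ psi psi_lin).
pose phi'L : {linear nsum F n -> Lquot L} := HB.pack phi'
  (GRing.isLinear.Build _ _ _ _ phi' (can2_linear (f := phiL) phiK phi'K)).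
pose psi'L : {linear {mpoly F[s]} -> sqI_mod L} := HB.pack psi'
  (GRing.isLinear.Build _ _ _ _ psi' (can2_linear (f := psiL) psiK psi'K)).
have n1 i : (1 < n i)%N by exact: ltnW.
pose z : L := repr (phi' (nbar F n i0 0)).
have piz : phi (pi z) = nbar F n i0 0 by rewrite /pi pi_repr phi'K.
have z_central x : ⁅x, z⁆ \in @sqI F L.
  apply/pi_eq0; apply: (can_inj phiK); rewrite pi_brk phi_brk -/pi piz.
  by rewrite brk_nbar0 // [RHS](linear0 phiL).
have z_id x : x \in @sqI F L -> ⁅x, z⁆ = x.
  move=> Ix; pose i : sqI_mod L := exist _ x Ix.
  rewrite -[x]/(val i) -sqI_act_pi; congr val; apply: (can_inj psiK).
  by rewrite psi_act -/pi piz fock_nbar // mul1r.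
pose sg := zlift z.
have sg_lin := zlift_linear z_id.
pose h (a : nsum F n * {mpoly F[s]}) : L := sg (phi' a.1) + val (psi' a.2).
pose h' (x : L) : nsum F n * {mpoly F[s]} :=
  (phi (pi x), psi (exist _ ⁅x, z⁆ (z_central x))).
exists h; split.
- move=> a [u p] [v q]; rewrite /h /=.
  have -> : phi' (a *: u + v) = a *: phi' u + phi' v := linearP phi'L a u v.
  have -> : psi' (a *: p + q) = a *: psi' p + psi' q := linearP psi'L a p q.
  have -> : sval (a *: psi' p + psi' q) = a *: sval (psi' p) + sval (psi' q) by [].
  by rewrite /sg sg_lin addrACA -scalerDr.
- exists h' => [[u p]|x]; rewrite /h' /h /=; last first.
    by rewrite phiK psiK /sg -zlift_decomp.
  congr pair; first rewrite /pi piD zliftK //.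
    by rewrite ((pi_eq0 _).2 (valP (psi' p))) addr0 phi'K.
  rewrite -[RHS]psi'K; congr psi; apply: val_inj => /=.
  by rewrite brkDl zlift_z // add0r; exact: z_id (valP (psi' p)).
- move=> [u p] [v q]; rewrite /h /=.
  rewrite brkDr (brk_sqI _ (valP (psi' q))) addr0 brkDl zlift_brk //.
  rewrite zlift_val //.
  have -> : ⁅phi' u, phi' v⁆ = phi' ⁅u, v⁆.
    by apply: (can_inj phiK); rewrite phi_brk !phi'K.
  have -> // : sqI_act (psi' p) (phi' v) = psi' (fock p v).
  by apply: (can_inj psiK); rewrite psi_act !psi'K phi'K.
Qed.

(** * The basis of the semidirect sum *)

Definition model_basis (a : FR_index n) : nsum F n * {mpoly F[s]} :=
  match a with
  | Bar i j => (nbar F n i j, 0)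
  | Der i => (nder F n i, 0)
  | Mon t => (0, 'X_[t])
  end.

Lemma bar_lt i (j : 'I_(n i).-1) : (j.+1 < n i)%N.
Proof. by have := ltn_ord j; lia. Qed.

Lemma fock0l (g : nsum F n) : fock 0 g = 0.
Proof.
rewrite /fock big1 // => i _; rewrite big1 // => j _.
by rewrite /fock_bas linear0 mulr0 scaler0; case: ifP; rewrite scaler0.
Qed.

Lemma fock0r p : fock p (0 : nsum F n) = 0.
Proof. by rewrite -(scale0r (0 : nsum F n)) fockZ scale0r. Qed.

(** Both predecessors agree unless [j = 0], where the scalar is zero. *)
Lemma nbar_pred i (j : 'I_(n i).-1) :
  j%:R *: nbar F n i j.-1 = j%:R *: nbar F n i (ord_pred j).
Proof.
have [->|j0] := eqVneq (j : nat) 0; first by rewrite !scale0r.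
congr (_ *: nbar F n i _); rewrite /=.
case: (nat_of_ord j) (ltn_ord j) j0 => // k kn _.
by rewrite addSn modnDr modn_small // ltnW.
Qed.

Lemma model_table a b :
  (⁅(model_basis a).1, (model_basis b).1⁆, fock (model_basis a).2 (model_basis b).1)
    = FR_table model_basis a b.
Proof.
case: a b => [i j|i|t] [k l|k|u] /=; rewrite ?fock0l ?fock0r ?brk0l ?brk0r //.
- by rewrite brk_nbar ?bar_lt.
- rewrite brk_nbar_nder ?bar_lt // nbar_pred; case: eqP => _ //.
  by congr pair; rewrite /= scaler0.
- rewrite brk_nder_nbar ?bar_lt // nbar_pred; case: eqP => _ //.
  by congr pair; rewrite /= scaler0 oppr0.
- by rewrite brk_nder.
- rewrite fock_nbar ?bar_lt //; congr pair.
  by rewrite addmC mpolyXD mpolyXn.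
- rewrite fock_nder 1?ltnW 1?ltnW // mderivX.
  by congr pair; rewrite /= scaler0.
Qed.

Lemma nx_coef i j k (l : 'I_(n k)) :
  (nx F n i j k : nfil F (n k)) 0 l = ((i == k) && (l.+1 == j))%:R.
Proof.
rewrite ffunE; have [ik|ik] := eqVneq i k.
  by case: _ / ik l => l; rewrite dfwith_in mxE.
by rewrite dfwith_out // mxE.
Qed.

Lemma nbar_coef i j k (l : 'I_(n k)) :
  (nbar F n i j k : nfil F (n k)) 0 l = (j`!)%:R * ((i == k) && (l.+1 == n i - j)%N)%:R.
Proof. by rewrite ffunE mxE nx_coef. Qed.

Lemma nsum_nx (u : nsum F n) :
  u = \sum_(i < s) \sum_(j < n i) (u i : nfil F (n i)) 0 j *: nx F n i j.+1.
Proof.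
have sumE (I : finType) (f : I -> nsum F n) k : (\sum_i f i) k = \sum_i f i k.
  by apply: (big_morph (fun v : nsum F n => v k)) => [v w|]; rewrite ffunE.
apply/ffunP => k; rewrite sumE (bigD1 k) //= [X in _ + X]big1 => [|i ik].
  rewrite addr0 sumE; apply/rowP => l; rewrite summxE (bigD1 l) //=.
  rewrite big1 => [|j jl]; rewrite ffunE mxE nx_coef eqxx /= eqSS.
    by rewrite eqxx mulr1 addr0.
  by rewrite val_eqE eq_sym (negPf jl) mulr0.
rewrite sumE big1 // => j _; apply/rowP => l.
by rewrite ffunE mxE nx_coef (negPf ik) mulr0 mxE.
Qed.

(** The element \overline{x_i^j} is j! x_{i,n_i-j}, whose 0-based position is
    n_i - j - 1, the mirror image of j in ['I_(n i)]; hence [rev_ord] and the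
    division by j!. *)
Definition model_coord (a : FR_index n) (v : nsum F n * {mpoly F[s]}) : F :=
  match a with
  | Bar i j => (j`!)%:R^-1 *
      (v.1 i : nfil F (n i)) 0 (rev_ord (widen_ord (leq_pred (n i)) j))
  | Der i => (v.1 i : nfil F (n i)) 0 (Ordinal (ltnW (ltnW (n_ge3 i))))
  | Mon t => v.2@_t
  end.

Lemma fact_neq0 k : (k`!)%:R != 0 :> F.
Proof. by rewrite ((pcharf0P F).1 charF) -lt0n fact_gt0. Qed.

Lemma model_coord_scalar a : scalar (model_coord a).
Proof.
case: a => [i j|i|t] c [u p] [v q] /=.
- by rewrite !ffunE !mxE mulrDr mulrCA.
- by rewrite !ffunE !mxE.
- by rewrite mcoeffD mcoeffZ.
Qed.

Lemma model_coord1 a : model_coord a (model_basis a) = 1.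
Proof.
case: a => [i j|i|t] /=.
- rewrite nbar_coef eqxx /= -subSn ?subSS; last by have := bar_lt j; lia.
  by rewrite eqxx mulr1 mulVf ?fact_neq0.
- by rewrite nx_coef !eqxx.
- by rewrite mcoeffX eqxx.
Qed.

Lemma model_coord0 a b : a <> b -> model_coord a (model_basis b) = 0.
Proof.
have zero_coef k (l : 'I_(n k)) : ((0 : nsum F n) k : nfil F (n k)) 0 l = 0.
  by rewrite ffunE mxE.
case: a b => [i j|i|t] [k l|k|u] /= ab; rewrite ?zero_coef ?mulr0 ?mcoeff0 //.
- rewrite nbar_coef; have [ki|_] := eqVneq k i; last by rewrite !mulr0.
  case: _ / ki j ab => j ab; case: eqP => /= [jl|_]; last by rewrite !mulr0.
  case: ab; congr Bar; apply: val_inj => /=.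
  by have := bar_lt j; have := bar_lt l; move: jl; lia.
- rewrite nx_coef; case: andP => [[_ /eqP /= kj]|_]; last by rewrite !mulr0.
  by have := bar_lt j; lia.
- rewrite nbar_coef; case: andP => [[_ /eqP /= kj]|_]; last by rewrite !mulr0.
  by have := bar_lt l; lia.
- by rewrite nx_coef; case: eqP => // ki; rewrite ki in ab.
- by rewrite mcoeffX; case: eqP => // ut; rewrite ut in ab.
Qed.

(** Up to a nonzero scalar, x_{i,1} is the derivation and every other x_{i,j}
    is some \overline{x_i^k}. *)
Lemma nx_span i (j : 'I_(n i)) : in_span model_basis (nx F n i j.+1, 0).
Proof.
have [j0|j0] := eqVneq (j : nat) 0.
  by rewrite j0; exact: (in_span_gen model_basis (Der n i)).
have kn : (n i - j.+1 < (n i).-1)%N by have := ltn_ord j; lia.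
have -> : (nx F n i j.+1, 0)
    = ((n i - j.+1)`!)%N%:R^-1 *: model_basis (Bar (Ordinal kn)).
  congr pair; last by rewrite /= scaler0.
  by rewrite /= scalerA mulVf ?fact_neq0 // scale1r subKn.
exact/in_spanZ/in_span_gen.
Qed.

Lemma model_span v : in_span model_basis v.
Proof.
have pairD (u u' : nsum F n) (p p' : {mpoly F[s]}) :
  in_span model_basis (u, p) -> in_span model_basis (u', p') ->
  in_span model_basis (u + u', p + p') by exact: in_spanD.
have pairZ c (u : nsum F n) (p : {mpoly F[s]}) :
  in_span model_basis (u, p) -> in_span model_basis (c *: u, c *: p).
  exact: in_spanZ.
have span0 : in_span model_basis (0, 0) := in_span0 model_basis.
case: v => u p; rewrite -[u]addr0 -[p]add0r; apply: (pairD).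
  have inlD w w' : in_span model_basis (w, 0) -> in_span model_basis (w', 0) ->
      in_span model_basis (w + w', 0).
    by move=> /pairD D /D; rewrite addr0.
  rewrite [u]nsum_nx.
  apply: (big_ind (fun w => in_span model_basis (w, 0))) => // i _.
  apply: (big_ind (fun w => in_span model_basis (w, 0))) => // j _.
  by rewrite -(scaler0 _ (u i 0 j)); exact/pairZ/nx_span.
rewrite [p]mpolyE.
apply: (big_ind (fun q => in_span model_basis (0, q))) => // [q q'|t _].
  by move=> /pairD D /D; rewrite addr0.
rewrite -(scaler0 _ p@_t); apply: pairZ.
exact: (in_span_gen model_basis (Mon n t)).
Qed.

Lemma model_basisP : is_basis model_basis.
Proof.
exact: dual_basis model_coord_scalar model_coord1 model_coord0 model_span.
Qed.

End Model.

(** * The multiplication table of L *)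

Unset Implicit Arguments.

Theorem theorem3 (F : closedFieldType) (charF : [pchar F] =i pred0)
  (s : nat) (s_ge1 : (1 <= s)%N) (n : 'I_s -> nat)
  (n_ge3 : forall i, (3 <= n i)%N) (L : leibnizType F) (L_FR : is_FR n L) :
  exists e : FR_index n -> L,
    is_basis e /\ forall a b, ⁅e a, e b⁆ = FR_table e a b.
Proof.
have [h [h_lin h_bij h_brk]] := FR_semidirect charF n_ge3 (Ordinal s_ge1) L_FR.
exists (h \o @model_basis F s n); split.
  exact: is_basis_iso h_lin h_bij (model_basisP charF n_ge3).
pose H : {linear (nsum F n * {mpoly F[s]})%type -> L} :=
  HB.pack h (GRing.isLinear.Build _ _ _ _ h h_lin).
have h0 : h 0 = 0 := linear0 H.
have hN v : h (- v) = - h v := linearN H v.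
have hZ c v : h (c *: v) = c *: h v := linearZ_LR H c v.
move=> a b; rewrite /comp h_brk model_table //.
by case: a b => [i j|i|t] [k l|k|u] //=; do ?[case: eqP => _]; rewrite ?hN ?hZ.
Qed.
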